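(* Let $L$ be a finite dimensional nilpotent Lie algebra over a field, of dimension greater than $1$ and of nilpotency class $c$. Then its Schur multiplier is non-zero: $M(L) \neq 0$.
   Context: All Lie algebras are over a fixed field. For a Lie algebra $L$, the lower central series is $L^1 = L$, $L^{i+1} = [L, L^i]$; $L$ is nilpotent of class $c$ if $L^{c+1} = 0$ and $L^c \neq 0$. The Schur multiplier of $L$ is $M(L) = (F^2 \cap R)/[F,R]$, where $F$ is a free Lie algebra, $R$ is an ideal of $F$ with $L \cong F/R$, and $F^2=[F,F]$; up to isomorphism this does not depend on the choice of the free presentation. *)

(* Defs.v *)
From HB Require Import structures.
From mathcomp Require Import all_boot all_algebra.
From mathcomp Require Import generic_quotient ring_quotient boolp.

Set Implicit Arguments.
Unset Strict Implicit.
Unset Printing Implicit Defensive.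

Import GRing.Theory.
Local Open Scope ring_scope.
Local Open Scope quotient_scope.

HB.mixin Record Lmodule_isLie (K : fieldType) V of GRing.Lmodule K V := {
  lie : V -> V -> V;
  lieDl : forall x y z, lie (x + y) z = lie x z + lie y z;
  lieDr : forall x y z, lie x (y + z) = lie x y + lie x z;
  lieZl : forall (k : K) x y, lie (k *: x) y = k *: lie x y;
  lieZr : forall (k : K) x y, lie x (k *: y) = k *: lie x y;
  liexx : forall x, lie x x = 0;
  lie_jacobi : forall x y z,
    lie x (lie y z) + lie y (lie z x) + lie z (lie x y) = 0
}.

#[short(type="lieAlgType")]
HB.structure Definition LieAlgebra (K : fieldType) :=
  {V of Lmodule_isLie K V & GRing.Lmodule K V}.

#[short(type="finLieAlgType")]
HB.structure Definition FinDimLieAlgebra (K : fieldType) :=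
  {V of LieAlgebra K V & Vector K V}.

Definition lie_hom (K : fieldType) (V W : lieAlgType K) (f : {linear V -> W}) :=
  forall x y, f (lie x y) = lie (f x) (f y).

Section Brackets.
Variables (K : fieldType) (V : lieAlgType K).

(* The linear span of the brackets [a, b] with a in A and b in B. *)
Definition lie_prod (A B : {pred V}) : {pred V} := fun z =>
  `[< exists n (k : 'I_n -> K) (a b : 'I_n -> V),
        [/\ forall i, a i \in A, forall i, b i \in B
          & z = \sum_(i < n) k i *: lie (a i) (b i)] >].

Lemma lie_prod_submod A B : submod_closed (lie_prod A B).
Proof.
split.
  by apply/asboolP; exists 0%N, (fun=> 0), (fun=> 0), (fun=> 0); split;
    [case | case | rewrite big_ord0].
move=> r u v /asboolP[n [k [a [b [aA bB ->]]]]].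
move=> /asboolP[m [l [c [d [cA dB ->]]]]]; apply/asboolP.
pose glue T (f : 'I_n -> T) (g : 'I_m -> T) i :=
  match split i with inl j => f j | inr j => g j end.
exists (n + m)%N, (glue _ (fun i => r * k i) l), (glue _ a c), (glue _ b d).
split=> [i|i|]; rewrite /glue; [by case: split | by case: split |].
rewrite big_split_ord scaler_sumr; congr (_ + _); apply: eq_bigr => i _.
  by rewrite (unsplitK (inl _ i)) scalerA.
by rewrite (unsplitK (inr _ i)).
Qed.

HB.instance Definition _ A B :=
  GRing.isSubmodClosed.Build K V (lie_prod A B) (lie_prod_submod A B).

(* Indexed as in L^1 = L, L^(i+1) = [L, L^i]; the index 0 is a dummy. *)
Fixpoint lower_central (i : nat) : {pred V} :=
  match i with
  | 0 | 1 => predT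
  | j.+1 => lie_prod predT (lower_central j)
  end.

(* This excludes c = 0, which would require both V = 0 and V <> 0. *)
Definition nilpotent_of_class (c : nat) :=
  {in lower_central c.+1, forall x, x = 0} /\
  (exists2 x, x \in lower_central c & x != 0).

End Brackets.

Arguments lower_central {K} V i _.
Arguments nilpotent_of_class {K} V c.

Section LmodQuotient.
Variables (R : pzRingType) (V : lmodType R) (U : submodClosed V).

(* Over a ring, a submodClosed predicate is closed under opposite, but the
   library only infers this for predicates declared by isSubmodClosed. *)
Definition submod_pred : {pred V} := fun x => x \in U.

Lemma submod_pred_closed : submod_closed submod_pred.
Proof. exact: submodClosedP. Qed.

HB.instance Definition _ :=
  GRing.isSubmodClosed.Build R V submod_pred submod_pred_closed.

Definition lmod_quot := @Quotient.quot V submod_pred.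

HB.instance Definition _ := GRing.Zmodule.on lmod_quot.

Definition lmod_pi (x : V) : lmod_quot := \pi_(@Quotient.quot V submod_pred) x.

Lemma lmod_pi_eq x y : lmod_pi x = lmod_pi y <-> x - y \in U.
Proof.
rewrite -[x - y \in U]/(x - y \in submod_pred) Quotient.idealrBE.
by split=> [/eqP|/eqP].
Qed.

Lemma lmod_piD x y : lmod_pi (x + y) = lmod_pi x + lmod_pi y.
Proof. exact: (@pi_addr _ _ _ _ _ (Quotient.quot submod_pred)). Qed.

Lemma lmod_piK (q : lmod_quot) : lmod_pi (repr (q : Quotient.quot submod_pred))
  = q.
Proof. exact: reprK. Qed.

Definition lmod_quot_scale (r : R) (q : lmod_quot) : lmod_quot :=
  lmod_pi (r *: repr (q : Quotient.quot submod_pred)).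

Lemma lmod_piZ r x : lmod_pi (r *: x) = lmod_quot_scale r (lmod_pi x).
Proof.
by apply/lmod_pi_eq; rewrite -scalerBr rpredZ//; apply/lmod_pi_eq;
  rewrite lmod_piK.
Qed.

Lemma lmod_quot_scaleA a b q :
  lmod_quot_scale a (lmod_quot_scale b q) = lmod_quot_scale (a * b) q.
Proof. by rewrite -[q]lmod_piK -!lmod_piZ scalerA. Qed.

Lemma lmod_quot_scale1 : left_id 1 lmod_quot_scale.
Proof. by move=> q; rewrite -[q]lmod_piK -!lmod_piZ scale1r. Qed.

Lemma lmod_quot_scaleDr : right_distributive lmod_quot_scale +%R.
Proof.
move=> r p q; rewrite -[p]lmod_piK -[q]lmod_piK.
by rewrite -lmod_piD -!lmod_piZ scalerDr lmod_piD.
Qed.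

Lemma lmod_quot_scaleDl q : {morph lmod_quot_scale^~ q : a b / a + b}.
Proof.
by move=> a b; rewrite -[q]lmod_piK -!lmod_piZ scalerDl lmod_piD.
Qed.

HB.instance Definition _ := GRing.Zmodule_isLmodule.Build R lmod_quot
  lmod_quot_scaleA lmod_quot_scale1 lmod_quot_scaleDr lmod_quot_scaleDl.

Lemma lmod_pi_linear : linear lmod_pi.
Proof. by move=> r x y; rewrite lmod_piD lmod_piZ. Qed.

HB.instance Definition _ :=
  GRing.isLinear.Build R V lmod_quot *:%R lmod_pi lmod_pi_linear.

End LmodQuotient.

Section SubspaceQuotient.
Variables (R : pzRingType) (V : lmodType R) (A B : submodClosed V).

Record subspace := Subspace { subspace_val : V; _ : subspace_val \in A }.
HB.instance Definition _ := [isSub of subspace for subspace_val].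
HB.instance Definition _ := [Choice of subspace by <:].
HB.instance Definition _ := [SubChoice_isSubLmodule of subspace by <:].

Definition subspace_trace : {pred subspace} := fun u => val u \in B.

Lemma subspace_trace_submod : submod_closed subspace_trace.
Proof.
split=> [|r u v uB vB]; rewrite /subspace_trace unfold_in ?raddf0 ?rpred0//.
by rewrite linearP rpredD ?rpredZ.
Qed.

HB.instance Definition _ :=
  GRing.isSubmodClosed.Build R subspace subspace_trace subspace_trace_submod.

(* A / B when B is contained in A (in general A / (A :&: B)). *)
Definition subspace_quot := lmod_quot subspace_trace.
HB.instance Definition _ := GRing.Lmodule.on subspace_quot.

End SubspaceQuotient.

Arguments subspace_trace {R V} A B _.

Definition is_free_lie (K : fieldType) (X : Type) (F : lieAlgType K)
    (gen : X -> F) : Prop :=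
  forall (M : lieAlgType K) (g : X -> M),
    (exists2 f : {linear F -> M}, lie_hom f & forall x, f (gen x) = g x) /\
    (forall f1 f2 : {linear F -> M}, lie_hom f1 -> lie_hom f2 ->
       (forall x, f1 (gen x) = g x) -> (forall x, f2 (gen x) = g x) ->
       f1 =1 f2).

(* An exact sequence 0 -> R -> F -> L -> 0 of Lie algebras with F free; the
   ideal R is the kernel of the surjection. *)
Record free_presentation (K : fieldType) (L : lieAlgType K) := FreePresentation {
  fp_gens : Type;
  fp_free : lieAlgType K;
  fp_gen : fp_gens -> fp_free;
  fp_freeP : is_free_lie fp_gen;
  fp_map : {linear fp_free -> L};
  fp_hom : lie_hom fp_map;
  fp_surj : forall y, exists x, fp_map x = y
}.

Section Multiplier.
Variables (K : fieldType) (L : lieAlgType K) (P : free_presentation L).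
Local Notation F := (fp_free P).

Definition fp_rel : {pred F} := fun x => fp_map P x == 0.

(* F^2 :&: R *)
Definition mult_num : {pred F} := [predI lower_central F 2 & fp_rel].

(* [F, R] *)
Definition mult_den : {pred F} := lie_prod predT fp_rel.

Lemma mult_num_submod : submod_closed mult_num.
Proof.
have [l0 ll] := @lie_prod_submod K F predT predT.
split=> [|r u v]; first by rewrite inE l0 unfold_in raddf0 eqxx.
rewrite !inE => /andP[u1 /eqP u2] /andP[v1 /eqP v2].
by rewrite [_ \in _](ll r u v)//= unfold_in linearP u2 v2 scaler0 addr0 eqxx.
Qed.

HB.instance Definition _ :=
  GRing.isSubmodClosed.Build K F mult_num mult_num_submod.
HB.instance Definition _ := GRing.SubmodClosed.on mult_den.

Lemma mult_den_sub : {subset mult_den <= mult_num}.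
Proof.
move=> _ /asboolP[n [k [a [b [_ bR ->]]]]]; apply: rpred_sum => i _.
rewrite rpredZ// inE; apply/andP; split.
  apply/asboolP; exists 1%N, (fun=> 1), (fun=> a i), (fun=> b i).
  by split=> //; rewrite big_ord1 scale1r.
have /eqP bi0 := bR i; rewrite unfold_in fp_hom bi0.
by rewrite -[X in lie _ X](scale0r 0) lieZr scale0r eqxx.
Qed.

(* M(L) = (F^2 :&: R) / [F, R] computed from the presentation P *)
Definition schur_multiplier := subspace_quot mult_num mult_den.
HB.instance Definition _ := GRing.Lmodule.on schur_multiplier.

End Multiplier.

Arguments fp_rel {K L} P _.
Arguments mult_num {K L} P _.
Arguments mult_den {K L} P _.

Section FreeLie.
Variables (K : fieldType) (X : Type).

Inductive lie_term : Type :=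
  | LGen of X
  | LZero
  | LOpp of lie_term
  | LAdd of lie_term & lie_term
  | LScale of K & lie_term
  | LBr of lie_term & lie_term.

Inductive lie_eq : lie_term -> lie_term -> Prop :=
  | le_refl t : lie_eq t t
  | le_sym s t : lie_eq s t -> lie_eq t s
  | le_trans s t u : lie_eq s t -> lie_eq t u -> lie_eq s u
  | le_opp s t : lie_eq s t -> lie_eq (LOpp s) (LOpp t)
  | le_add s s' t t' :
      lie_eq s s' -> lie_eq t t' -> lie_eq (LAdd s t) (LAdd s' t')
  | le_scale k s t : lie_eq s t -> lie_eq (LScale k s) (LScale k t)
  | le_br s s' t t' :
      lie_eq s s' -> lie_eq t t' -> lie_eq (LBr s t) (LBr s' t')
  | le_addA s t u : lie_eq (LAdd s (LAdd t u)) (LAdd (LAdd s t) u)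
  | le_addC s t : lie_eq (LAdd s t) (LAdd t s)
  | le_add0 s : lie_eq (LAdd LZero s) s
  | le_addN s : lie_eq (LAdd (LOpp s) s) LZero
  | le_scaleA a b s : lie_eq (LScale a (LScale b s)) (LScale (a * b) s)
  | le_scale1 s : lie_eq (LScale 1 s) s
  | le_scaleDr a s t :
      lie_eq (LScale a (LAdd s t)) (LAdd (LScale a s) (LScale a t))
  | le_scaleDl a b s :
      lie_eq (LScale (a + b) s) (LAdd (LScale a s) (LScale b s))
  | le_brDl s t u : lie_eq (LBr (LAdd s t) u) (LAdd (LBr s u) (LBr t u))
  | le_brDr s t u : lie_eq (LBr s (LAdd t u)) (LAdd (LBr s t) (LBr s u))
  | le_brZl a s t : lie_eq (LBr (LScale a s) t) (LScale a (LBr s t))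
  | le_brZr a s t : lie_eq (LBr s (LScale a t)) (LScale a (LBr s t))
  | le_brxx s : lie_eq (LBr s s) LZero
  | le_jacobi s t u :
      lie_eq (LAdd (LAdd (LBr s (LBr t u)) (LBr t (LBr u s)))
                   (LBr u (LBr s t))) LZero.

HB.instance Definition _ := gen_eqMixin lie_term.
HB.instance Definition _ := gen_choiceMixin lie_term.

Definition lie_eqb (s t : lie_term) := `[< lie_eq s t >].

Lemma lie_eqb_equiv : equiv_class_of lie_eqb.
Proof.
split=> [t|s t|t s u].
- by apply/asboolP; constructor.
- by apply/asboolP/asboolP; apply: le_sym.
- by move=> /asboolP st /asboolP tu; apply/asboolP; apply: le_trans tu.
Qed.

Canonical lie_eqb_rel := EquivRelPack lie_eqb_equiv.

Definition free_lie := {eq_quot lie_eqb_rel}.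
HB.instance Definition _ := Choice.on free_lie.

Definition fl_pi (t : lie_term) : free_lie := \pi_({eq_quot lie_eqb_rel}) t.
Definition fl_repr (q : free_lie) : lie_term :=
  repr (q : {eq_quot lie_eqb_rel}).

Lemma fl_reprK q : fl_pi (fl_repr q) = q. Proof. exact: reprK. Qed.

Lemma fl_piP s t : fl_pi s = fl_pi t <-> lie_eq s t.
Proof.
split=> [/eqP|st]; first by rewrite eqmodE => /asboolP.
by apply/eqP; rewrite eqmodE; apply/asboolP.
Qed.

Lemma fl_piK t : lie_eq (fl_repr (fl_pi t)) t.
Proof. by apply/fl_piP; rewrite fl_reprK. Qed.

Definition fl_opp p := fl_pi (LOpp (fl_repr p)).
Definition fl_add p q := fl_pi (LAdd (fl_repr p) (fl_repr q)).
Definition fl_scale k p := fl_pi (LScale k (fl_repr p)).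
Definition fl_br p q := fl_pi (LBr (fl_repr p) (fl_repr q)).

Lemma fl_oppE s : fl_opp (fl_pi s) = fl_pi (LOpp s).
Proof. by apply/fl_piP; apply: le_opp; apply: fl_piK. Qed.
Lemma fl_addE s t : fl_add (fl_pi s) (fl_pi t) = fl_pi (LAdd s t).
Proof. by apply/fl_piP; apply: le_add; apply: fl_piK. Qed.
Lemma fl_scaleE k s : fl_scale k (fl_pi s) = fl_pi (LScale k s).
Proof. by apply/fl_piP; apply: le_scale; apply: fl_piK. Qed.
Lemma fl_brE s t : fl_br (fl_pi s) (fl_pi t) = fl_pi (LBr s t).
Proof. by apply/fl_piP; apply: le_br; apply: fl_piK. Qed.
Let flE := (fl_oppE, fl_addE, fl_scaleE, fl_brE).

Lemma fl_addA : associative fl_add.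
Proof.
move=> p q r; rewrite -[p]fl_reprK -[q]fl_reprK -[r]fl_reprK !flE.
by apply/fl_piP; constructor.
Qed.
Lemma fl_addC : commutative fl_add.
Proof.
move=> p q; rewrite -[p]fl_reprK -[q]fl_reprK !flE.
by apply/fl_piP; apply: le_addC.
Qed.
Lemma fl_add0 : left_id (fl_pi LZero) fl_add.
Proof. by move=> p; rewrite -[p]fl_reprK !flE; apply/fl_piP; constructor. Qed.
Lemma fl_addN : left_inverse (fl_pi LZero) fl_opp fl_add.
Proof. by move=> p; rewrite -[p]fl_reprK !flE; apply/fl_piP; constructor. Qed.

HB.instance Definition _ :=
  GRing.isZmodule.Build free_lie fl_addA fl_addC fl_add0 fl_addN.

Lemma fl_scaleA a b p : fl_scale a (fl_scale b p) = fl_scale (a * b) p.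
Proof. by rewrite -[p]fl_reprK !flE; apply/fl_piP; constructor. Qed.
Lemma fl_scale1 : left_id 1 fl_scale.
Proof. by move=> p; rewrite -[p]fl_reprK !flE; apply/fl_piP; constructor. Qed.
Lemma fl_scaleDr : right_distributive fl_scale +%R.
Proof.
move=> a p q; rewrite -[p]fl_reprK -[q]fl_reprK /GRing.add /= !flE.
by apply/fl_piP; constructor.
Qed.
Lemma fl_scaleDl p : {morph fl_scale^~ p : a b / a + b}.
Proof.
move=> a b; rewrite -[p]fl_reprK {2}/GRing.add /= !flE.
by apply/fl_piP; constructor.
Qed.

HB.instance Definition _ := GRing.Zmodule_isLmodule.Build K free_lie
  fl_scaleA fl_scale1 fl_scaleDr fl_scaleDl.

Lemma fl_brDl p q r : fl_br (p + q) r = fl_br p r + fl_br q r.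
Proof.
rewrite -[p]fl_reprK -[q]fl_reprK -[r]fl_reprK /GRing.add /= !flE.
by apply/fl_piP; constructor.
Qed.
Lemma fl_brDr p q r : fl_br p (q + r) = fl_br p q + fl_br p r.
Proof.
rewrite -[p]fl_reprK -[q]fl_reprK -[r]fl_reprK /GRing.add /= !flE.
by apply/fl_piP; constructor.
Qed.
Lemma fl_brZl (k : K) p q : fl_br (k *: p) q = k *: fl_br p q.
Proof.
rewrite -[p]fl_reprK -[q]fl_reprK /GRing.scale /= !flE.
by apply/fl_piP; constructor.
Qed.
Lemma fl_brZr (k : K) p q : fl_br p (k *: q) = k *: fl_br p q.
Proof.
rewrite -[p]fl_reprK -[q]fl_reprK /GRing.scale /= !flE.
by apply/fl_piP; constructor.
Qed.
Lemma fl_brxx p : fl_br p p = 0.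
Proof. by rewrite -[p]fl_reprK !flE; apply/fl_piP; constructor. Qed.
Lemma fl_jacobi p q r :
  fl_br p (fl_br q r) + fl_br q (fl_br r p) + fl_br r (fl_br p q) = 0.
Proof.
rewrite -[p]fl_reprK -[q]fl_reprK -[r]fl_reprK /GRing.add /= !flE.
by apply/fl_piP; constructor.
Qed.

HB.instance Definition _ := Lmodule_isLie.Build K free_lie
  fl_brDl fl_brDr fl_brZl fl_brZr fl_brxx fl_jacobi.

Definition free_gen (x : X) : free_lie := fl_pi (LGen x).

Section Eval.
Variables (M : lieAlgType K) (g : X -> M).

Fixpoint lie_eval (t : lie_term) : M :=
  match t with
  | LGen x => g x
  | LZero => 0
  | LOpp s => - lie_eval s
  | LAdd s t => lie_eval s + lie_eval t
  | LScale k s => k *: lie_eval s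
  | LBr s t => lie (lie_eval s) (lie_eval t)
  end.

Lemma lie_eval_eq s t : lie_eq s t -> lie_eval s = lie_eval t.
Proof.
elim=> {s t} /=; do ?by [move=> *; congruence].
- by move=> s t u; rewrite addrA.
- by move=> s t; rewrite addrC.
- by move=> s; rewrite add0r.
- by move=> s; rewrite addNr.
- by move=> a b s; rewrite scalerA.
- by move=> s; rewrite scale1r.
- by move=> a s t; rewrite scalerDr.
- by move=> a b s; rewrite scalerDl.
- by move=> s t u; rewrite lieDl.
- by move=> s t u; rewrite lieDr.
- by move=> a s t; rewrite lieZl.
- by move=> a s t; rewrite lieZr.
- by move=> s; rewrite liexx.
- by move=> s t u; rewrite lie_jacobi.
Qed.

Definition free_lift (q : free_lie) : M := lie_eval (fl_repr q).

Lemma free_liftE t : free_lift (fl_pi t) = lie_eval t.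
Proof. exact/lie_eval_eq/fl_piK. Qed.

Lemma free_lift_linear : linear free_lift.
Proof.
move=> k p q; rewrite -[p]fl_reprK -[q]fl_reprK.
by rewrite /GRing.scale /= /GRing.add /= !flE !free_liftE.
Qed.

HB.instance Definition _ :=
  GRing.isLinear.Build K free_lie M *:%R free_lift free_lift_linear.

Lemma free_lift_hom : lie_hom free_lift.
Proof.
move=> p q; rewrite -[p]fl_reprK -[q]fl_reprK.
by rewrite [in LHS]/lie /= !flE !free_liftE.
Qed.

Lemma free_lift_unique (f : {linear free_lie -> M}) :
  lie_hom f -> (forall x, f (free_gen x) = g x) -> f =1 free_lift.
Proof.
move=> fh fg q; rewrite -[q]fl_reprK free_liftE.
elim: (fl_repr q) => {q} /= [x||s <-|s <- t <-|k s <-|s <- t <-].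
- exact: fg.
- exact: raddf0.
- by rewrite -raddfN -fl_oppE.
- by rewrite -raddfD -fl_addE.
- by rewrite -linearZ -fl_scaleE.
- by rewrite -fh -fl_brE.
Qed.

End Eval.

Lemma free_lieP : is_free_lie free_gen.
Proof.
move=> M g; split.
  by exists (free_lift g); [exact: free_lift_hom | move=> x; exact: free_liftE].
move=> f1 f2 h1 h2 g1 g2 q.
by rewrite (free_lift_unique h1 g1) (free_lift_unique h2 g2).
Qed.

End FreeLie.

Lemma free_presentation_exists (K : fieldType) (L : lieAlgType K) :
  inhabited (free_presentation L).
Proof.
have idP x : free_lift (id : L -> L) (free_gen K x) = x by exact: free_liftE.
split; apply: (FreePresentation (@free_lieP K L) (@free_lift_hom K L L id)).
by move=> y; exists (free_gen K y); exact: idP.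
Qed.

(* Main.v *)
Require Import Defs.
From HB Require Import structures.
From mathcomp Require Import all_boot all_algebra.
From mathcomp Require Import boolp ring.

Set Implicit Arguments.
Unset Strict Implicit.
Unset Printing Implicit Defensive.

Import GRing.Theory.
Local Open Scope ring_scope.

(** The idea is Dixmier's proof that a nilpotent Lie algebra of dimension at
    least 2 has a nonzero second cohomology group.

    A 2-cocycle [w] on [L] with values in the ground field defines a central
    extension [E] of [L].  By freeness the presentation [F -> L] lifts to
    [F -> E]; the lift sends [R] into the central kernel, hence kills [[F, R]].
    If a relation [\sum_i k_i [a_i, b_i] = 0] of [L] has
    [\sum_i k_i w(a_i, b_i) != 0], then lifting the [a_i] and [b_i] to [F]
    gives an element of [F^2 :&: R] with nonzero image in [E], so outside
    [[F, R]] ([schur_multiplier_neq0]).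

    To find such a cocycle, let [xi] be a nonzero linear form vanishing on
    [L^2], let [I] be its kernel and let [xi x = 1].  Then [I] is an ideal; it is
    nonzero because [dim L > 1], so [I <> [I, I]] by nilpotency.  As [ad x] acts
    nilpotently on [I / [I, I]], some [v] in [I] outside [[I, I]] satisfies
    [[x, v] \in [I, I]] ([exists_ad_kernel_mod]).  With [phi] a linear form
    vanishing on [[I, I]] and equal to 1 at [v], the form
    [xi /\ phi] is a cocycle ([wedge_cocycle]); it takes the value [phi v = 1] on
    the pair [(x, v)] and vanishes on [I], so it detects the relation that
    writes [[x, v]] as a combination of brackets of elements of [I]. *)

(** * Brackets and nilpotency *)

Section BracketTheory.
Variables (K : fieldType) (V : lieAlgType K).
Implicit Types (x y : V) (A B : {pred V}).

Lemma lieC x y : lie x y = - lie y x.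
Proof.
have := liexx (x + y); rewrite lieDl !lieDr !liexx add0r addr0.
by move=> /eqP; rewrite addr_eq0 => /eqP.
Qed.

Lemma lie_prodP A B a b : a \in A -> b \in B -> lie a b \in lie_prod A B.
Proof.
move=> aA bB; apply/asboolP.
exists 1%N, (fun=> 1), (fun=> a), (fun=> b).
by split=> //; rewrite big_ord1 scale1r.
Qed.

Lemma lie_prodS A A' B B' :
  {subset A <= A'} -> {subset B <= B'} ->
  {subset lie_prod A B <= lie_prod A' B'}.
Proof.
move=> sA sB _ /asboolP[n [k [a [b [aA bB ->]]]]].
by apply/asboolP; exists n, k, a, b; split=> // i; [exact: sA | exact: sB].
Qed.

(** Such an [A] lies in every term of the lower central series. *)
Lemma nilpotent_perfect_eq0 c A :
  nilpotent_of_class V c -> {subset A <= lie_prod A A} ->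
  {in A, forall x, x = 0}.
Proof.
move=> [nil _] sA x xA; apply: nil.
elim: c x xA => [//|n IHn] x xA.
exact: lie_prodS (sA _ xA).
Qed.

Lemma iter_lie_lower_central n x y :
  iter n (lie x) y \in lower_central V n.+1.
Proof. by elim: n => [//|n IHn]; exact: lie_prodP. Qed.

(** When [I] is an ideal distinct from [[I, I]], this says that [ad x], being
    nilpotent, has a nonzero kernel on [I / [I, I]]. *)
Lemma exists_ad_kernel_mod c (I : {pred V}) x w :
    nilpotent_of_class V c ->
    (forall u, u \in I -> lie x u \in I) ->
    w \in I -> w \notin lie_prod I I ->
  exists v, [/\ v \in I, v \notin lie_prod I I & lie x v \in lie_prod I I].
Proof.
move=> [nil _] xI wI wJ.
have ex : exists n, iter n (lie x) w \in lie_prod I I.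
  by exists c; rewrite (nil _ (iter_lie_lower_central c x w)) rpred0.
(* [v] is the last iterate of [ad x] on [w] that is outside [[I, I]]. *)
have [[|n] nJ minn] := ex_minnP ex; first by rewrite nJ in wJ.
exists (iter n (lie x) w); split=> //.
  by elim: n {nJ minn} => [//|n IHn]; exact: xI.
by apply/negP => /minn; rewrite ltnn.
Qed.

End BracketTheory.

(** * Linear forms *)

Lemma exists_linear_form (K : fieldType) (V : vectType K) (S : submodClosed V)
    (v : V) :
    v \notin S ->
  exists2 phi : {linear V -> K^o}, phi v = 1 & {in S, forall s, phi s = 0}.
Proof.
move=> vS.
(* A subspace of maximal dimension contained in [S] is equal to [S]. *)
pose P n := `[< exists2 U : {vspace V}, \dim U = n & {subset U <= S} >].
have exP : exists n, P n.
  exists 0%N; apply/asboolP; exists 0%VS; first exact: dimv0.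
  by move=> u; rewrite memv0 => /eqP ->; exact: rpred0.
have leP n : P n -> (n <= \dim {: V})%N.
  by move=> /asboolP[U <- _]; exact/dimvS/subvf.
have [_ /asboolP[U <- US] maxU] := ex_maxnP exP leP.
have SU s : s \in S -> s \in U.
  move=> sS.
  have /maxU le_dim : P (\dim (U + <[s]>)).
    apply/asboolP; exists (U + <[s]>)%VS => // z.
    move=> /memv_addP[u uU [t /vlineP[k ->] ->]].
    by apply: rpredD; [exact: US | exact: rpredZ].
  have := dimv_leqif_eq (addvSl U <[s]>).
  rewrite eq_sym => /geq_leqif; rewrite le_dim => /esym/eqP <-.
  by rewrite (subvP (addvSr U _)) ?memv_line.
(* [id - projv U] has kernel [U]; one of its coordinates is nonzero at [v]. *)
pose p u := u - projv U u.
have pv0 : p v != 0.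
  by apply: contra vS; rewrite subr_eq0 => /eqP ->; exact/US/memv_proj.
pose X := vbasis {: V}.
have [i ci0] : exists i, coord X i (p v) != 0.
  apply/existsP; apply: contraNT pv0; rewrite negb_exists => /forallP all0.
  rewrite (coord_vbasis (memvf (p v))) big1// => i _.
  by have /negPn/eqP -> := all0 i; rewrite scale0r.
pose phi u : K^o := (coord X i (p v))^-1 * coord X i (p u).
have phi_lin : linear phi.
  move=> k u w; rewrite /phi /p linearP /= opprD addrACA -scalerBr linearP.
  by rewrite /= mulrDr mulrCA.
pose phiM := GRing.isLinear.Build K V K^o *:%R phi phi_lin.
pose phiL : {linear V -> K^o} := HB.pack phi phiM.
exists phiL => [|s sS]; rewrite -[LHS]/(phi _) /phi ?mulVf//.
by rewrite {2}/p (projv_id (SU s sS)) subrr linear0 mulr0.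
Qed.

(** * Central extensions *)

(** A 2-cocycle of [L] with values in the trivial module [K]. *)
Record lie_cocycle (K : fieldType) (L : lieAlgType K) := LieCocycle {
  cocycle_val :> L -> L -> K^o;
  cocycleDl : forall x y z,
    cocycle_val (x + y) z = cocycle_val x z + cocycle_val y z;
  cocycleDr : forall x y z,
    cocycle_val x (y + z) = cocycle_val x y + cocycle_val x z;
  cocycleZl : forall (k : K) x y, cocycle_val (k *: x) y = k *: cocycle_val x y;
  cocycleZr : forall (k : K) x y, cocycle_val x (k *: y) = k *: cocycle_val x y;
  cocyclexx : forall x, cocycle_val x x = 0;
  cocycle_jacobi : forall x y z,
    cocycle_val x (lie y z) + cocycle_val y (lie z x)
      + cocycle_val z (lie x y) = 0
}.

Section CentralExtension.
Variables (K : fieldType) (L : lieAlgType K) (w : lie_cocycle L).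

(** The extension of [L] by the central line [0 * K] defined by [w]. *)
Definition central_ext : Type := (L * K^o)%type.
HB.instance Definition _ := GRing.Lmodule.copy central_ext (L * K^o)%type.

Definition ext_lie (p q : central_ext) : central_ext :=
  (lie p.1 q.1, w p.1 q.1).

Lemma ext_lieDl p q r : ext_lie (p + q) r = ext_lie p r + ext_lie q r.
Proof. by rewrite /ext_lie /= lieDl cocycleDl. Qed.
Lemma ext_lieDr p q r : ext_lie p (q + r) = ext_lie p q + ext_lie p r.
Proof. by rewrite /ext_lie /= lieDr cocycleDr. Qed.
Lemma ext_lieZl (k : K) p q : ext_lie (k *: p) q = k *: ext_lie p q.
Proof. by rewrite /ext_lie /= lieZl cocycleZl. Qed.
Lemma ext_lieZr (k : K) p q : ext_lie p (k *: q) = k *: ext_lie p q.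
Proof. by rewrite /ext_lie /= lieZr cocycleZr. Qed.
Lemma ext_liexx p : ext_lie p p = 0.
Proof. by rewrite /ext_lie liexx cocyclexx. Qed.
Lemma ext_lie_jacobi p q r :
  ext_lie p (ext_lie q r) + ext_lie q (ext_lie r p) + ext_lie r (ext_lie p q)
  = 0.
Proof.
by congr (_, _); [exact: lie_jacobi | exact: cocycle_jacobi].
Qed.

HB.instance Definition _ := Lmodule_isLie.Build K central_ext
  ext_lieDl ext_lieDr ext_lieZl ext_lieZr ext_liexx ext_lie_jacobi.

(** By freeness, a presentation of [L] lifts to the extension. *)
Lemma presentation_lift (P : free_presentation L) :
  exists2 f : {linear fp_free P -> central_ext},
    lie_hom f & forall z, (f z).1 = fp_map P z.
Proof.
pose g x : central_ext := (fp_map P (fp_gen x), 0).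
have [[f fh fg] _] := fp_freeP g.
exists f => // z.
(* [fp_map P] and the first component of [f] agree on the generators. *)
pose h u : L := (f u).1.
have h_lin : linear h by move=> k u v; rewrite /h linearP.
pose hM := GRing.isLinear.Build K (fp_free P) L *:%R h h_lin.
pose hL : {linear fp_free P -> L} := HB.pack h hM.
have [_ uniq] := fp_freeP (fun x => fp_map P (fp_gen x)).
apply: (uniq hL (fp_map P)) => //; last 1 first.
- by move=> x; rewrite /hL/= /h fg.
- by move=> u v; rewrite /hL/= /h fh.
- exact: fp_hom.
Qed.

End CentralExtension.

(** A cocycle that does not vanish on some linear relation between brackets of
    [L] (a cocycle that is not a coboundary) forces the multiplier to be
    nonzero. *)
Lemma schur_multiplier_neq0 (K : fieldType) (L : lieAlgType K)
    (w : lie_cocycle L) (P : free_presentation L)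
    n (k : 'I_n -> K) (a b : 'I_n -> L) :
    \sum_(i < n) k i *: lie (a i) (b i) = 0 ->
    \sum_(i < n) k i *: w (a i) (b i) != 0 ->
  exists m : schur_multiplier P, m != 0.
Proof.
move=> rel0 w_neq0.
have [f fh f1] := presentation_lift w P.
have [a' a'E] := choice (fun i => fp_surj P (a i)).
have [b' b'E] := choice (fun i => fp_surj P (b i)).
pose r := \sum_(i < n) k i *: lie (a' i) (b' i).
have r_num : r \in mult_num P.
  rewrite inE; apply/andP; split.
    by rewrite rpred_sum// => i _; rewrite rpredZ// lie_prodP.
  rewrite unfold_in /r -rel0 linear_sum; apply/eqP; apply: eq_bigr => i _.
  by rewrite linearZ /= fp_hom a'E b'E.
have f2_sum m (l : 'I_m -> K) (c d : 'I_m -> fp_free P) :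
    (f (\sum_(i < m) l i *: lie (c i) (d i))).2 =
    \sum_(i < m) l i *: w (fp_map P (c i)) (fp_map P (d i)).
  rewrite linear_sum /= (raddf_sum (snd : L * K^o -> K^o)).
  by apply: eq_bigr => i _; rewrite linearZ /= fh /= !f1.
have w0 x : w x 0 = 0.
  by rewrite -[X in w _ X](scale0r 0) cocycleZr scale0r.
pose U := subspace_trace (mult_num P) (mult_den P).
exists (lmod_pi U (Subspace r_num)); apply/eqP => r0.
have r_den : Subspace r_num - 0 \in U.
  by apply/lmod_pi_eq; rewrite [RHS]linear0.
move: r_den; rewrite subr0 => r_den.
have {r_den}/asboolP[m [l [c [d [_ dR rE]]]]] : r \in mult_den P by [].
move: w_neq0; under eq_bigr do rewrite -a'E -b'E.
rewrite -f2_sum -/r rE f2_sum big1 ?eqxx// => i _.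
by have /eqP -> := dR i; rewrite w0 scaler0.
Qed.

(** * The wedge product of two linear forms *)

(** [xi /\ phi] is a cocycle when [xi] is a cocycle of degree 1 and [phi] is
    one on the kernel of [xi]: then [d phi] is a multiple of [xi], so that
    [d (xi /\ phi) = - xi /\ d phi = 0]. *)
Lemma wedge_cocycle (K : fieldType) (L : lieAlgType K)
    (xi phi : {linear L -> K^o}) (x : L) :
    (forall u v, xi (lie u v) = 0) -> xi x = 1 ->
    (forall u v, xi u = 0 -> xi v = 0 -> phi (lie u v) = 0) ->
  exists w : lie_cocycle L, forall u v, w u v = xi u * phi v - xi v * phi u.
Proof.
move=> xi_lie xix phi_lie.
have split_x t : exists2 t0, xi t0 = 0 & t = (xi t : K) *: x + t0.
  exists (t - (xi t : K) *: x); last by rewrite subrKC.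
  by rewrite linearB linearZ /= xix [_ *: _]mulr1 subrr.
have phiE u v : phi (lie u v) =
    xi u * phi (lie x v) - xi v * phi (lie x u).
  have [u0 u0K uE] := split_x u; have [v0 v0K vE] := split_x v.
  have luv : lie u v =
      lie u0 v0 + ((xi u : K) *: lie x v0 - (xi v : K) *: lie x u0).
    rewrite [in LHS]uE [in LHS]vE lieDl !lieDr !lieZl !lieZr liexx !scaler0.
    by rewrite add0r (lieC u0 x) scalerN [- _ + _]addrC addrCA.
  have lx t t0 : t = (xi t : K) *: x + t0 -> lie x t = lie x t0.
    by move=> ->; rewrite lieDr lieZr liexx scaler0 add0r.
  rewrite luv (lx u u0 uE) (lx v v0 vE) linearD linearB !linearZ /=.
  by rewrite phi_lie// add0r.
unshelve eexists (@LieCocycle K L (fun u v => xi u * phi v - xi v * phi u)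
  _ _ _ _ _ _) => //=.
- by move=> u v t; rewrite !linearD /=; ring.
- by move=> u v t; rewrite !linearD /=; ring.
- by move=> k u v; rewrite !linearZ /= /GRing.scale /=; ring.
- by move=> k u v; rewrite !linearZ /= /GRing.scale /=; ring.
- by move=> u; rewrite subrr.
- by move=> u v t; rewrite !xi_lie (phiE v) (phiE t) (phiE u); ring.
Qed.

Theorem theorem3p2 (K : fieldType) (L : finLieAlgType K) (c : nat)
    (dim_gt1 : (1 < \dim {: L})%N) (nil_c : nilpotent_of_class L c)
    (P : free_presentation L) :
  exists m : schur_multiplier P, m != 0.
Proof.
have [x xL2] : exists x : L, x \notin lie_prod predT predT.
  apply: contrapT => /forallNP all_in.
  have L0 : {in (predT : {pred L}), forall u, u = 0}.
    apply: (nilpotent_perfect_eq0 nil_c) => u _.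
    by apply/negPn/negP; exact: all_in.
  by have [_ [u _ /eqP[]]] := nil_c; exact: L0.
have [xi xix xi_L2] := exists_linear_form xL2.
have xi_lie u v : xi (lie u v) = 0 by apply: xi_L2; exact: lie_prodP.
pose I : {pred L} := fun u => xi u == 0.
have [w wI wJ] : exists2 w, w \in I & w \notin lie_prod I I.
  apply: contrapT => noW.
  have I0 : {in I, forall u, u = 0}.
    apply: (nilpotent_perfect_eq0 nil_c) => u uI.
    by apply/negPn/negP => uJ; apply: noW; exists u.
  have : (\dim {: L} <= 1)%N.
    apply: (@leq_trans (\dim <[x]>)); last by rewrite dim_vline leq_b1.
    apply/dimvS/subvP => u _; apply/vlineP; exists (xi u).
    apply/subr0_eq/I0/eqP.
    by rewrite linearB linearZ /= xix [_ *: _]mulr1 subrr.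
  by rewrite leqNgt dim_gt1.
have [v [vI vJ xvJ]] := exists_ad_kernel_mod nil_c
  (fun u _ => introT eqP (xi_lie x u)) wI wJ.
have [phi phiv phiJ] := exists_linear_form vJ.
have phi_lie u t : xi u = 0 -> xi t = 0 -> phi (lie u t) = 0.
  by move=> /eqP u0 /eqP t0; apply: phiJ; exact: lie_prodP.
have [om omE] := wedge_cocycle xi_lie xix phi_lie.
have /asboolP[n [k [a [b [aI bI xvE]]]]] := xvJ.
(* The relation [[x, v] - \sum_i k_i [a_i, b_i] = 0]; [cons t f] has value [t]
   at index 0, followed by the values of [f]. *)
pose cons T (t : T) (f : 'I_n -> T) (i : 'I_n.+1) := oapp f t (unlift ord0 i).
apply: (@schur_multiplier_neq0 K L om P n.+1 (cons _ 1 (fun i => - k i))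
  (cons _ x a) (cons _ v b)).
  rewrite big_ord_recl /cons unlift_none /= scale1r.
  under eq_bigr do rewrite liftK /= scaleNr.
  by rewrite sumrN -xvE subrr.
rewrite big_ord_recl /cons unlift_none /= scale1r big1 ?addr0 => [|i _].
  by rewrite omE xix (eqP vI) phiv mul0r subr0 mulr1 oner_neq0.
by rewrite liftK /= omE (eqP (aI i)) (eqP (bI i)) !mul0r subr0 scaler0.
Qed.
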